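(* Let $P$ be any distribution on $\mathbb R$ with mean $\mu\in\mathbb R$ and variance $\sigma^2\in(0,\infty)$, and let $X_1,X_2,\dots$ be i.i.d. from $P$. Let $\{\widetilde\mu_n\}_{n\ge0}$ (real) and $\{\widetilde\sigma_n\}_{n\ge0}$ (positive) be adapted to $\{\mathcal F_n\}_{n\ge0}$, and suppose there are $\gamma>0$ and $C<\infty$ such that, for all $n\ge1$, $\mathbb E[|\widetilde\mu_n-\mu|^3]\le Cn^{-\gamma}$ and $\mathbb E[(\widetilde\sigma_n^{-2}-\sigma^{-2})^2]\le Cn^{-\gamma}$; that $\widetilde\sigma_n^{-2}\to\sigma^{-2}$ almost surely; and that $\limsup_{n\to\infty}\mathbb E[\widetilde\sigma_n^{-6}]<\infty$. Define $$R_n=\left(\frac1n\sum_{i=1}^nX_i^2\right)^{n/2}\mathrm e^{n/2}\prod_{i=1}^n\frac1{\widetilde\sigma_{i-1}}\exp\left\{-\frac12\left(\frac{X_i-\widetilde\mu_{i-1}}{\widetilde\sigma_{i-1}}\right)^2\right\}.$$ Then $$\lim_{n\to\infty}\frac{\log R_n}{n}=\frac12\log\left(1+\mu^2/\sigma^2\right)\quad\text{almost surely}.$$ Consequently, when $P=N(\mu,\sigma^2)$ with $\mu\ne0$, $R_n$ diverges almost surely to $\infty$ exponentially fast (i.e. $\liminf_n n^{-1}\log R_n>0$ almost surely).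
   Context: $\mathcal F_n=\sigma(X_1,\dots,X_n)$ is the canonical filtration, $\mathcal F_0$ trivial; ''adapted'' means $\widetilde\mu_n,\widetilde\sigma_n$ are $\mathcal F_n$-measurable. $N(\mu,\sigma^2)$ is the normal distribution with mean $\mu$ and variance $\sigma^2$. *)

(* Defs.v *)
From HB Require Import structures.
From mathcomp Require Import all_boot all_order all_algebra finmap.
From mathcomp Require Import all_classical all_reals all_analysis.

Set Implicit Arguments.
Unset Strict Implicit.
Unset Printing Implicit Defensive.

Import Order.TTheory GRing.Theory Num.Theory.
Import numFieldNormedType.Exports.

Local Open Scope classical_set_scope.
Local Open Scope ring_scope.

(* Sequences of observations are indexed from 0: [X i] is the observation
   usually written X_{i+1}. *)

Definition mutually_independent (d : measure_display) (T : measurableType d)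
    (R : realType) (Pr : probability T R) (X : nat -> {RV Pr >-> R}) : Prop :=
  forall (J : {fset nat}) (B : nat -> set R),
    (forall i, measurable (B i)) ->
    Pr (\bigcap_(i in [set` J]) (X i @^-1` B i)) =
    (\prod_(i <- J) Pr (X i @^-1` B i))%E.

Definition iid_from (d : measure_display) (T : measurableType d)
    (R : realType) (Pr : probability T R) (P : probability R R)
    (X : nat -> {RV Pr >-> R}) : Prop :=
  mutually_independent X /\
  forall i (A : set R), measurable A -> distribution Pr (X i) A = P A.

(* The sigma-algebra generated by the first [n] observations; for [n = 0] it is
   generated by the empty family, hence trivial. *)
Definition canonical_filtration (d : measure_display) (T : measurableType d)
    (R : realType) (X : nat -> T -> R) (n : nat) : set (set T) :=
  g_sigma_preimage (fun i : 'I_n => X i).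

Definition adapted (T : Type) (R : realType) (F : nat -> set (set T))
    (Y : nat -> T -> R) : Prop :=
  forall n (B : set R), measurable B -> F n (Y n @^-1` B).

(* With the indexing above, the i-th factor (i < n) pairs X_{i+1} with the
   estimators computed from the first [i] observations. *)
Definition likelihood_ratio (T : Type) (R : realType)
    (X mut sigmat : nat -> T -> R) (n : nat) (w : T) : R :=
  (n%:R^-1 * \sum_(i < n) X i w ^+ 2) `^ (n%:R / 2) * expR (n%:R / 2) *
  \prod_(i < n) ((sigmat i w)^-1 *
     expR (- 2^-1 * ((X i w - mut i w) / sigmat i w) ^+ 2)).

(* [lne] maps 0 to -oo, unlike the real-valued [ln]. *)
Definition log_growth (T : Type) (R : realType)
    (X mut sigmat : nat -> T -> R) (n : nat) (w : T) : \bar R :=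
  ((n%:R^-1)%:E * lne (likelihood_ratio X mut sigmat n w)%:E)%E.

(* Main.v *)
Require Import Defs.
From HB Require Import structures.
From mathcomp Require Import all_boot all_order all_algebra finmap.
From mathcomp Require Import all_classical all_reals all_analysis.
From mathcomp Require Import measurable_realfun.
From mathcomp Require Import ring lra zify.

(* Expanding (X - m)^2 s = (X - mu)^2 s + 2 (X - mu) (mu - m) s + (m - mu)^2 s,
   with m and s the estimates of mu and sigma^-2, the whole convergence happens
   pathwise.  The first term averages to 1 by the strong law of large numbers and
   a.s. convergence of s.  The moment bound makes sum_i |m_i - mu|^3 / i a.s.
   finite, so by Kronecker's lemma |m - mu|^3, hence (m - mu)^2, averages to 0; the
   cross term follows by AM-GM.  No martingale argument is needed.  The strong law
   is only needed for nonnegative functions of the observations, for which pairwise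
   independence suffices, as in Etemadi's proof. *)

Set Implicit Arguments.
Unset Strict Implicit.
Unset Printing Implicit Defensive.

Import Order.TTheory GRing.Theory Num.Theory.
Import numFieldNormedType.Exports.

Local Open Scope classical_set_scope.
Local Open Scope ring_scope.

(** * Running means of real sequences: Cesaro and Kronecker lemmas, products, powers *)

Definition mean (R : realType) (u : nat -> R) (n : nat) : R :=
  n%:R^-1 * \sum_(i < n) u i.

Lemma cvg_mean (R : realType) (u : nat -> R) (l : R) :
  u @ \oo --> l -> mean u @ \oo --> l.
Proof.
move=> /cesaro ul; rewrite -cvg_shiftS; apply: cvg_trans ul; apply: near_eq_cvg.
by near=> n; rewrite /arithmetic_mean /mean /series/= big_mkord.
Unshelve. all: end_near. Qed.

Lemma meanD (R : realType) (u v : nat -> R) n :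
  mean (fun i => u i + v i) n = mean u n + mean v n.
Proof. by rewrite /mean big_split mulrDr. Qed.

Lemma meanZ (R : realType) (c : R) (u : nat -> R) n :
  mean (fun i => c * u i) n = c * mean u n.
Proof. by rewrite /mean -mulr_sumr mulrCA. Qed.

Lemma mean_cst (R : realType) (c : R) n : mean (fun=> c) n.+1 = c.
Proof. by rewrite /mean sumr_const card_ord -[c *+ _]mulr_natl mulKf// pnatr_eq0. Qed.

Lemma ler_mean (R : realType) (u v : nat -> R) n :
  (forall i, u i <= v i) -> mean u n <= mean v n.
Proof. by move=> uv; apply: ler_wpM2l; rewrite ?invr_ge0 ?ler0n ?ler_sum. Qed.

Lemma mean_ge0 (R : realType) (u : nat -> R) n :
  (forall i, 0 <= u i) -> 0 <= mean u n.
Proof. by move=> u0; apply: mulr_ge0; rewrite ?invr_ge0 ?ler0n ?sumr_ge0. Qed.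

Lemma ler_norm_mean (R : realType) (u : nat -> R) n :
  `|mean u n| <= mean (fun i => `|u i|) n.
Proof.
rewrite /mean normrM ger0_norm ?invr_ge0 ?ler0n//.
by apply: ler_wpM2l; rewrite ?invr_ge0 ?ler0n ?ler_norm_sum.
Qed.

(* Abel summation: the mean of [u] is the n-th partial sum of [u i / (i + 1)]
   minus the mean of the previous partial sums. *)
Lemma kronecker (R : realType) (u : nat -> R) :
  cvgn (series (fun i => u i / i.+1%:R)) -> mean u @ \oo --> (0 : R).
Proof.
set T := series _ => cT.
(* For [n > 0] the last summand is 0 and the identity is Abel summation divided by [n]; at [n = 0]
   every term is 0. *)
have -> : mean u = fun n => T n - mean T n + (n == 0%N)%:R * mean u 0%N.
  apply/funext => -[|n]; first by rewrite /mean /T /series/= big_geq// !big_ord0 mulr0; lra.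
  rewrite mul0r addr0.
  have E m : \sum_(i < m) u i = m%:R * T m - \sum_(i < m) T i.
    elim: m => [|m IH]; first by rewrite !big_ord0 mul0r subr0.
    rewrite !big_ord_recr/= IH /T seriesSr -natr1.
    field; by rewrite natr1 pnatr_eq0.
  by rewrite /mean E mulrBr mulKf// pnatr_eq0.
rewrite -[X in _ --> X](_ : limn T - limn T + 0 * mean u 0%N = 0); last by lra.
apply: cvgD; first by apply: cvgB => //; exact: cvg_mean.
apply: cvgMr_tmp; rewrite -(cvg_shiftS (fun n => (n == 0%N)%:R : R))/=; exact: cvg_cst.
Qed.

(** Beyond some [N] the factor [|v i|] is below [e / 2 / (m + 1)], so the tail costs at most
    [e / 2], as [mean y n] is eventually at most [m + 1]. The block before [N] has a sum bounded by
    the constant [K], which division by [n] makes negligible. *)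
Lemma cvg_mean_mul0 (R : realType) (y v : nat -> R) (m : R) :
  (forall i, 0 <= y i) -> mean y @ \oo --> m -> v @ \oo --> (0 : R) ->
  mean (fun i => y i * v i) @ \oo --> (0 : R).
Proof.
move=> y0 ym v0; apply/cvgr0Pnorm_le => e e0.
have m0 : 0 <= m.
  rewrite -(cvg_lim _ ym)//; apply: limr_ge; first exact: cvgP ym.
  by apply: nearW => n; exact: mean_ge0.
have d0 : 0 < e / 2 / (m + 1) by rewrite !divr_gt0// ltr_wpDl.
have [N _ Nv] := (cvgr0Pnorm_le _).1 v0 _ d0.
set K := \sum_(i < N) `|y i * v i|.
have cK : (fun n => n%:R^-1 * K) @ \oo --> (0 : R).
  rewrite -[X in _ --> X](mul0r K); apply: cvgMr_tmp.
  by apply/gtr0_cvgV0; [near=> n; rewrite ltr0n; near: n; exact: nbhs_infty_gt|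
    exact: cvgr_idn].
have e20 : 0 < e / 2 by rewrite divr_gt0.
near=> n.
have yn : mean y n <= m + 1.
  have : `|m - mean y n| <= 1 by near: n; move/cvgrPdist_le : ym => /(_ _ ltr01).
  by rewrite ler_norml => /andP[]; lra.
have Kn : n%:R^-1 * K <= e / 2.
  apply: le_trans (ler_norm _) _; near: n; exact: ((cvgr0Pnorm_le _).1 cK).
apply: le_trans (ler_norm_mean _ _) _.
have Nn : (N <= n)%N by near: n; exact: nbhs_infty_ge.
have S : \sum_(i < n) `|y i * v i| <= K + \sum_(i < n) (e / 2 / (m + 1)) * y i.
  rewrite -(big_mkord xpredT (fun i => `|y i * v i|)) (big_cat_nat _ (n := N))//=.
  rewrite -(big_mkord xpredT (fun i => _ * y i)) [in leRHS](big_cat_nat _ (n := N))//=.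
  rewrite /K -(big_mkord xpredT (fun i => `|y i * v i|)) lerD2l.
  apply: ler_wpDl; first by apply: sumr_ge0 => i _; apply: mulr_ge0 => //; exact: ltW.
  rewrite big_nat_cond [leRHS]big_nat_cond; apply: ler_sum => i /andP[/andP[Ni _] _].
  rewrite normrM (ger0_norm (y0 _)) mulrC ler_wpM2r//; exact: Nv.
rewrite [e](_ : _ = e / 2 + (e / 2 / (m + 1)) * (m + 1)); last first.
  by field; rewrite gt_eqF// ltr_wpDl.
apply: (@le_trans _ _ (n%:R^-1 * K + (e / 2 / (m + 1)) * mean y n)).
  rewrite -meanZ /mean -mulrDr; by apply: ler_wpM2l.
by apply: lerD => //; rewrite ler_pM2l.
Unshelve. all: end_near. Qed.

Lemma cvg_mean_mul (R : realType) (y v : nat -> R) (m l : R) :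
  (forall i, 0 <= y i) -> mean y @ \oo --> m -> v @ \oo --> l ->
  mean (fun i => y i * v i) @ \oo --> m * l.
Proof.
move=> y0 ym vl.
have -> : mean (fun i => y i * v i) =
    (fun n => mean (fun i => y i * (v i - l)) n + l * mean y n).
  by apply/funext => n; rewrite -meanZ -meanD; congr mean; apply/funext => i; ring.
rewrite -[X in _ --> X]add0r [in m * l]mulrC; apply: cvgD.
  apply: (@cvg_mean_mul0 _ _ _ m) => //.
  by rewrite -(subrr l); apply: cvgB => //; exact: cvg_cst.
by apply: cvgMl_tmp.
Qed.

(** For every [t > 0], [a ^ 2 <= t ^ 2 + |a| ^ 3 / t]: the first term suffices when [|a| <= t], the
    second when [|a| > t]. *)
Lemma cvg_mean_sqr (R : realType) (a : nat -> R) :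
  mean (fun i => `|a i| ^+ 3) @ \oo --> (0 : R) ->
  mean (fun i => a i ^+ 2) @ \oo --> (0 : R).
Proof.
move=> a3; apply/cvgr0Pnorm_le => e e0.
(* Capping [t] at 1 gives [t ^ 2 <= t <= e / 2]. *)
pose t := Num.min (e / 2) 1.
have t0 : 0 < t by rewrite lt_min ltr01 divr_gt0.
have te : t ^+ 2 <= e / 2.
  have t1 : t <= 1 by rewrite ge_min lexx orbT.
  have : t <= e / 2 by rewrite ge_min lexx.
  by apply: le_trans; rewrite expr2 ler_piMr// ltW.
have e2t : 0 < e / 2 * t by rewrite mulr_gt0// divr_gt0.
near=> n.
rewrite ger0_norm; last by apply: mean_ge0 => i; exact: sqr_ge0.
have n0 : (0 < n)%N by near: n; exact: nbhs_infty_gt.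
apply: (@le_trans _ _ (mean (fun i => t ^+ 2 + t^-1 * `|a i| ^+ 3) n)).
  apply: ler_mean => i; rewrite -(real_normK (num_real (a i))).
  have := normr_ge0 (a i); move: `|a i| => b b0.
  have [bt|/ltW tb] := leP b t.
    rewrite -[leLHS]addr0 lerD ?mulr_ge0 ?invr_ge0 ?exprn_ge0 ?(ltW t0)//.
    by rewrite lerXn2r ?nnegrE// ltW.
  apply: (@le_trans _ _ (t^-1 * b ^+ 3)); last by rewrite ler_wpDl// sqr_ge0.
  by rewrite ler_pdivlMl// [in leRHS]exprS ler_wpM2r// sqr_ge0.
rewrite meanD (meanZ t^-1) -{1}(prednK n0) mean_cst.
rewrite [leRHS]splitr lerD// ler_pdivrMl// mulrC.
apply: le_trans (ler_norm _) _; near: n; exact: ((cvgr0Pnorm_le _).1 a3).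
Unshelve. all: end_near. Qed.

(** The error of centering at [m i] rather than [mu] is bounded with a free weight [t]: a small [t]
    tames the main average [a], and the large factor [1 + 1 / t] falls on [b], which tends to 0. *)
Lemma cvg_mean_standardized (R : realType) (x m s : nat -> R) (mu l v : R) :
  (forall i, 0 <= s i) -> s @ \oo --> l ->
  mean (fun i => (x i - mu) ^+ 2) @ \oo --> v ->
  mean (fun i => `|m i - mu| ^+ 3) @ \oo --> (0 : R) ->
  mean (fun i => (x i - m i) ^+ 2 * s i) @ \oo --> v * l.
Proof.
move=> s0 sl xv /cvg_mean_sqr m2.
have A : mean (fun i => (x i - mu) ^+ 2 * s i) @ \oo --> v * l.
  by apply: cvg_mean_mul => // i; exact: sqr_ge0.
have B : mean (fun i => (m i - mu) ^+ 2 * s i) @ \oo --> (0 : R).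
  by rewrite -(mul0r l); apply: cvg_mean_mul => // i; exact: sqr_ge0.
set a := mean _ in A; set b := mean _ in B.
have a0 n : 0 <= a n by apply: mean_ge0 => i; rewrite mulr_ge0// sqr_ge0.
have b0 n : 0 <= b n by apply: mean_ge0 => i; rewrite mulr_ge0// sqr_ge0.
set q := mean _.
suff D : (fun n => q n - a n) @ \oo --> (0 : R).
  rewrite -[v * l]add0r (_ : q = fun n => (q n - a n) + a n); first exact: cvgD.
  by apply/funext => n; rewrite subrK.
(* 2 |(x - mu) (m - mu)| <= t (x - mu)^2 + (m - mu)^2 / t *)
have le (t : R) n : 0 < t -> `|q n - a n| <= t * a n + (1 + t^-1) * b n.
  move=> t0; rewrite /q /a /b -mulN1r -(meanZ (-1)) -meanD.
  rewrite -!meanZ -meanD; apply: le_trans (ler_norm_mean _ _) _.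
  apply: ler_mean => i; have := s0 i; move: (s i) (x i) (m i) => si xi mi si0.
  rewrite mulN1r -mulrBl normrM (ger0_norm si0) !mulrA -mulrDl ler_wpM2r//.
  pose p := xi - mu; pose r := mi - mu.
  have -> : xi - mi = p - r by rewrite /p /r; lra.
  rewrite -/p -/r.
  have h1 : 0 <= t * (p - t^-1 * r) ^+ 2 by rewrite mulr_ge0 ?sqr_ge0 ?ltW.
  have h2 : 0 <= t * (p + t^-1 * r) ^+ 2 by rewrite mulr_ge0 ?sqr_ge0 ?ltW.
  have e1 : t * (p - t^-1 * r) ^+ 2 = t * p ^+ 2 - 2 * p * r + t^-1 * r ^+ 2.
    by field; rewrite gt_eqF.
  have e2 : t * (p + t^-1 * r) ^+ 2 = t * p ^+ 2 + 2 * p * r + t^-1 * r ^+ 2.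
    by field; rewrite gt_eqF.
  have := sqr_ge0 r.
  rewrite e1 in h1; rewrite e2 in h2.
  by rewrite ler_norml => r0; apply/andP; split; lra.
apply/cvgr0Pnorm_le => e e0.
have w0 : 0 < `|v * l| + 1 by rewrite ltr_wpDl.
(* Eventually [a n <= |v * l| + 1], so this [t] makes [t * a n] at most [e / 2]. *)
pose t := e / 2 / (`|v * l| + 1).
have t0 : 0 < t by rewrite !divr_gt0.
have e20 : 0 < e / 2 by rewrite divr_gt0.
have cb : (fun n => (1 + t^-1) * b n) @ \oo --> (0 : R).
  by rewrite -(mulr0 (1 + t^-1)); apply: cvgMl_tmp.
near=> n.
apply: le_trans (le t n t0) _.
rewrite [e]splitr; apply: lerD.
  rewrite -[leRHS](@divfK _ (`|v * l| + 1)) ?gt_eqF// -/t ler_pM2l//.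
  have : `|v * l - a n| <= 1 by near: n; move/cvgrPdist_le : A => /(_ _ ltr01).
  rewrite ler_norml => /andP[h _]; have := ler_norm (v * l); lra.
apply: le_trans (ler_norm _) _; near: n; exact: ((cvgr0Pnorm_le _).1 cb).
Unshelve. all: end_near. Qed.

(** * The growth rate along a single path *)

Lemma cvg_log_growth (T : Type) (R : realType) (X mut sigmat : nat -> T -> R)
    (w : T) (mu sigma : R) :
  0 < sigma -> (forall n, 0 < sigmat n w) ->
  mean (fun i => X i w ^+ 2) @ \oo --> mu ^+ 2 + sigma ^+ 2 ->
  mean (fun i => (X i w - mu) ^+ 2) @ \oo --> sigma ^+ 2 ->
  mean (fun i => `|mut i w - mu| ^+ 3) @ \oo --> (0 : R) ->
  (fun n => sigmat n w ^- 2) @ \oo --> sigma ^- 2 ->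
  (fun n => log_growth X mut sigmat n w) @ \oo -->
    (2^-1 * ln (1 + mu ^+ 2 / sigma ^+ 2))%:E.
Proof.
move=> s0 st0 x2 xmu2 m3 scvg.
have q : mean (fun i => (X i w - mut i w) ^+ 2 * sigmat i w ^- 2) @ \oo --> (1 : R).
  rewrite -[X in _ --> X](@mulfV _ (sigma ^+ 2)) ?gt_eqF ?exprn_gt0//.
  apply: cvg_mean_standardized xmu2 m3 => // i.
  by rewrite invr_ge0 exprn_ge0// ltW.
have lns : mean (fun i => ln (sigmat i w ^- 2)) @ \oo --> ln (sigma ^- 2).
  apply: cvg_mean; apply: (cvg_comp _ _ scvg).
  by apply: continuous_ln; rewrite invr_gt0 exprn_gt0.
have v0 : 0 < mu ^+ 2 + sigma ^+ 2 by rewrite ltr_wpDl ?sqr_ge0 ?exprn_gt0.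
have lnx : (fun n => ln (mean (fun i => X i w ^+ 2) n)) @ \oo -->
    ln (mu ^+ 2 + sigma ^+ 2).
  by apply: (cvg_comp _ _ x2); exact: continuous_ln.
(* The summand 1 comes from the factor [expR (n / 2)]; it cancels the limit 1 of the standardized
   squares. *)
have -> : 2^-1 * ln (1 + mu ^+ 2 / sigma ^+ 2) =
    2^-1 * (ln (mu ^+ 2 + sigma ^+ 2) + 1 + ln (sigma ^- 2) - 1).
  rewrite (addrAC _ 1) addrK -lnM ?posrE ?invr_gt0 ?exprn_gt0//.
  by rewrite mulrDl divff ?gt_eqF ?exprn_gt0// addrC.
(* [L n] is [log R_n / n] in terms of running means, with [- ln sigmat] written as half of
   [ln (sigmat ^- 2)]. *)
pose L n := 2^-1 * (ln (mean (fun i => X i w ^+ 2) n) + 1 +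
  mean (fun i => ln (sigmat i w ^- 2)) n -
  mean (fun i => (X i w - mut i w) ^+ 2 * sigmat i w ^- 2) n).
have cL : L @ \oo --> 2^-1 * (ln (mu ^+ 2 + sigma ^+ 2) + 1 + ln (sigma ^- 2) - 1).
  apply: cvgMl_tmp; apply: cvgB => //; apply: cvgD => //.
  by apply: cvgD => //; exact: cvg_cst.
apply: (@cvg_trans _ ((fun n => (L n)%:E) @ \oo)); last first.
  by apply: cvg_comp cL _; exact: cvg_id.
apply: near_eq_cvg; near=> n.
have n0 : (0 < n)%N by near: n; exact: nbhs_infty_gt.
have nR : n%:R != 0 :> R by rewrite pnatr_eq0 -lt0n.
(* The limit [mu ^ 2 + sigma ^ 2] is positive, so eventually the likelihood ratio is positive and
   [lne] agrees with [ln]. *)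
have xn0 : 0 < mean (fun i => X i w ^+ 2) n.
  by near: n; move/cvgr_gt : x2; apply.
have f0 i : 0 < (sigmat i w)^-1 *
     expR (- 2^-1 * ((X i w - mut i w) / sigmat i w) ^+ 2).
  by rewrite mulr_gt0 ?invr_gt0 ?expR_gt0.
rewrite /log_growth /likelihood_ratio -/(mean (fun i => X i w ^+ 2) n).
rewrite lne_EFin; last by rewrite !mulr_gt0 ?powR_gt0 ?expR_gt0 ?prodr_gt0.
rewrite !lnM ?posrE ?mulr_gt0 ?powR_gt0 ?expR_gt0 ?prodr_gt0//.
rewrite ln_powR expRK -EFinM; congr EFin.
have -> : ln (\prod_(i < n) ((sigmat i w)^-1 *
     expR (- 2^-1 * ((X i w - mut i w) / sigmat i w) ^+ 2))) =
  \sum_(i < n) 2^-1 * (ln (sigmat i w ^- 2) - (X i w - mut i w) ^+ 2 * sigmat i w ^- 2).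
  elim: (n) => [|k IH]; first by rewrite !big_ord0 ln1.
  rewrite !big_ord_recr/= lnM ?posrE ?prodr_gt0// IH; congr (_ + _).
  rewrite lnM ?posrE ?invr_gt0 ?expR_gt0// expRK.
  rewrite -exprVn lnXn ?invr_gt0// expr_div_n -exprVn -mulr_natl.
  by field; rewrite gt_eqF.
rewrite -mulr_sumr sumrB /L /mean.
by field.
Unshelve. all: end_near. Qed.

(** * Tools for the strong law: integrability, series of functions, geometric sums, dyadic
    subsequences *)

Lemma bounded_integrable (d : measure_display) (T : measurableType d)
    (R : realType) (P : probability T R) (f : T -> R) (M : R) :
  measurable_fun [set: T] f -> (forall x, `|f x| <= M) ->
  P.-integrable [set: T] (EFin \o f).
Proof.
move=> mf fM; apply: measurable_bounded_integrable => //.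
  by apply: (le_lt_trans _ (ltry 1)); exact: probability_le1.
exists M; split; first exact: num_real.
by move=> x Mx y _; apply: le_trans (fM y) (ltW Mx).
Qed.

(** By monotone convergence the total sum has finite integral, hence is finite almost everywhere,
    where it bounds the nondecreasing partial sums. This takes the place of a Borel-Cantelli
    argument. *)
Lemma ae_cvg_series (d : measure_display) (T : measurableType d)
    (R : realType) (mu : {measure set T -> \bar R}) (f : nat -> T -> R) :
  (forall n, measurable_fun [set: T] (f n)) -> (forall n w, 0 <= f n w) ->
  (\sum_(0 <= n <oo) \int[mu]_w (f n w)%:E < +oo)%E ->
  {ae mu, forall w, cvgn (series (f ^~ w))}.
Proof.
move=> mf f0; rewrite -integral_nneseries//; last 2 first.
- by move=> n; exact/measurable_EFinP.
- by move=> n w _; rewrite lee_fin.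
move=> foo.
have : mu.-integrable [set: T] (fun w => \sum_(0 <= n <oo) (f n w)%:E)%E.
  apply/integrableP; split.
    apply: ge0_emeasurable_sum => [n w _ _|n _]; first by rewrite lee_fin.
    exact/measurable_EFinP.
  apply: le_lt_trans foo; apply: ge0_le_integral => //.
  - apply: measurableT_comp => //; apply: ge0_emeasurable_sum => [n w _ _|n _].
      by rewrite lee_fin.
    exact/measurable_EFinP.
  - apply: ge0_emeasurable_sum => [n w _ _|n _]; first by rewrite lee_fin.
    exact/measurable_EFinP.
  - by move=> w _; rewrite gee0_abs//; apply: nneseries_ge0 => n _ _; rewrite lee_fin.
move=> /integrable_ae => /(_ measurableT); apply: filterS => w /(_ Logic.I) fin.
apply: nondecreasing_is_cvgn.
  by apply: nondecreasing_series => n _ _; exact: f0.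
exists (fine (\sum_(0 <= n <oo) (f n w)%:E)%E) => _ [n _ <-].
rewrite -lee_fin fineK// /series/= -sumEFin.
by apply: nneseries_lim_ge => k _ _; rewrite lee_fin.
Qed.

(* The bound [2 * min y (y ^+ 2 / k)] is stable under doubling [k]. *)
Lemma sum_geometric_tail (R : realType) (y k : R) (N : nat) : 0 <= y -> 0 < k ->
  \sum_(n < N) (y <= k * 2 ^+ n)%R%:R * (y ^+ 2 / (k * 2 ^+ n)) <= 2 * y.
Proof.
move=> y0; suff H : forall k : R, 0 < k ->
    \sum_(n < N) (y <= k * 2 ^+ n)%R%:R * (y ^+ 2 / (k * 2 ^+ n)) <=
    2 * Num.min y (y ^+ 2 / k).
  by move=> k0; apply: le_trans (H _ k0) _; rewrite ler_pM2l// ge_min lexx.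
elim: N => [|N IH] {}k k0.
  by rewrite big_ord0 mulr_ge0// le_min y0 divr_ge0 ?sqr_ge0 ?ltW.
have k2 : 0 < k * 2 by rewrite mulr_gt0.
have {}IH := IH _ k2.
rewrite big_ord_recl expr0 mulr1.
rewrite (eq_bigr (fun n : 'I_N =>
    (y <= k * 2 * 2 ^+ n)%R%:R * (y ^+ 2 / (k * 2 * 2 ^+ n)))); last first.
  by move=> i _; rewrite lift0 exprS (mulrA k).
apply: le_trans (lerD (lexx _) IH) _.
(* If [y <= k], the first term adds [y ^ 2 / k] to twice [y ^ 2 / (2 * k)], exactly the claimed
   bound; if [k < y], the first term is 0 and the bound is [2 * y]. *)
have [yk|ky] := leP y k.
  have -> : Num.min y (y ^+ 2 / k) = y ^+ 2 / k.
    by apply/min_idPr; rewrite ler_pdivrMr// expr2 ler_wpM2l.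
  apply: (@le_trans _ _ (1 * (y ^+ 2 / k) + 2 * (y ^+ 2 / (k * 2)))).
    by rewrite lerD2l ler_pM2l// ge_min lexx orbT.
  by rewrite le_eqVlt; apply/orP; left; apply/eqP; field; rewrite gt_eqF.
rewrite mul0r add0r.
have -> : Num.min y (y ^+ 2 / k) = y.
  by apply/min_idPl; rewrite ler_pdivlMr// expr2 ler_wpM2l// ltW.
by rewrite ler_pM2l// ge_min lexx.
Qed.

(** The terms double while they stay below [y]. The sharper bound, [2 * y - k] for [k < y] and 0
    otherwise, is inductive because [k + (2 * y - 2 * k) = 2 * y - k]. *)
Lemma sum_geometric_head (R : realType) (y k : R) (N : nat) : 0 <= y -> 0 < k ->
  \sum_(n < N) (k * 2 ^+ n < y)%R%:R * (k * 2 ^+ n) <= 2 * y.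
Proof.
move=> y0; suff H : forall k : R, 0 < k ->
    \sum_(n < N) (k * 2 ^+ n < y)%R%:R * (k * 2 ^+ n) <=
    if k < y then 2 * y - k else 0.
  move=> k0; apply: le_trans (H _ k0) _; case: ifPn => _; last by rewrite mulr_ge0.
  by rewrite lerBlDr lerDl ltW.
elim: N => [|N IH] {}k k0.
  by rewrite big_ord0; case: ifPn => // ky; lra.
have k2 : 0 < k * 2 by rewrite mulr_gt0.
have {}IH := IH _ k2.
rewrite big_ord_recl expr0 mulr1.
rewrite (eq_bigr (fun n : 'I_N => (k * 2 * 2 ^+ n < y)%R%:R * (k * 2 * 2 ^+ n)));
  last by move=> i _; rewrite lift0 exprS (mulrA k).
apply: le_trans (lerD (lexx _) IH) _.
by have [h1|h1] := ltP k y; have [h2|h2] := ltP (k * 2) y;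
  rewrite /= ?mul1r ?mul0r; lra.
Qed.

(* For [M * 2 ^ n <= k < 2 * M * 2 ^ n], monotonicity of the partial sums traps the
   mean at [k] between those at [j * 2 ^ n] and [j.+1 * 2 ^ n], with
   [j = k %/ 2 ^ n >= M], up to a factor [1 + 1 / M]. *)
Lemma cvg_mean_dyadic (R : realType) (y : nat -> R) (m : R) :
  (forall i, 0 <= y i) ->
  (forall j, (fun n => mean y (j.+1 * 2 ^ n)) @ \oo --> m) ->
  mean y @ \oo --> m.
Proof.
move=> y0 ym.
have m0 : 0 <= m.
  rewrite -(cvg_lim _ (ym 0%N))//; apply: limr_ge; first exact: cvgP (ym _).
  by apply: nearW => n; exact: mean_ge0.
have Tle a b : (a <= b)%N -> \sum_(i < a) y i <= \sum_(i < b) y i.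
  move=> ab; rewrite -!(big_mkord xpredT y) [leRHS](@big_cat_nat _ _ _ a)//=.
  by rewrite lerDl sumr_ge0.
apply/cvgrPdist_le => e e0.
(* Closeness 1 keeps the sampled means below [m + 1]; closeness [e / 2] uses half of the allowed
   error. *)
pose dl : R := Num.min 1 (e / 2).
have dl0 : 0 < dl by rewrite lt_min ltr01 divr_gt0.
have dl1 : dl <= 1 by rewrite ge_min lexx.
have dle : dl <= e / 2 by rewrite ge_min lexx orbT.
(* The factor [1 + 1 / M] costs at most [(m + 1) / M <= e / 2], the other half of the error. *)
pose M := (Num.bound (2 * (m + 1) / e)).+1.
have M0 : 0 < M%:R :> R by rewrite ltr0n.
have Me : (m + 1) / M%:R <= e / 2.
  have : 2 * (m + 1) / e < M%:R.
    apply: lt_le_trans (archi_boundP _) _; last by rewrite ler_nat.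
    by rewrite divr_ge0 ?mulr_ge0 ?addr_ge0// ltW.
  rewrite ltr_pdivrMr// ler_pdivrMr// => /ltW; lra.
(* The values of [j] in use stay below [2 * M], so finitely many limits give one common
   threshold. *)
have near_all : \forall n \near \oo, forall j, (j < M.*2)%N ->
    `|m - mean y (j.+1 * 2 ^ n)| <= dl.
  elim: (M.*2) => [|B IH]; first by apply: nearW.
  have /cvgrPdist_le/(_ _ dl0) := ym B; apply: filterS2 IH => n IH HB j.
  by rewrite ltnS leq_eqVlt => /predU1P[->//|]; exact: IH.
have [N _ HN] := near_all.
exists (M * 2 ^ N)%N => // k /= Mk.
(* The largest [n] with [M * 2 ^ n <= k]; it forces [M <= j < 2 * M]. *)
pose n := trunc_log 2 (k %/ M).
have kM0 : (0 < k %/ M)%N.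
  by rewrite divn_gt0// (leq_trans _ Mk)// leq_pmulr// expn_gt0.
have n1 : (M * 2 ^ n <= k)%N by rewrite mulnC -leq_divRL// trunc_logP.
have n2 : (k < M * 2 ^ n.+1)%N by rewrite mulnC -ltn_divLR// trunc_log_ltn.
have Nn : (N <= n)%N by apply: trunc_log_max => //; rewrite leq_divRL// mulnC.
pose j := (k %/ 2 ^ n)%N.
have p0 : (0 < 2 ^ n)%N by rewrite expn_gt0.
have Mj : (M <= j)%N by rewrite leq_divRL.
have jM : (j < M.*2)%N by rewrite ltn_divLR// -muln2 -mulnA -expnS.
have jk : (j * 2 ^ n <= k)%N by exact: leq_trunc_div.
have kj : (k <= j.+1 * 2 ^ n)%N by rewrite ltnW// -ltn_divLR.
have j0 : (0 < j)%N by exact: leq_trans Mj.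
have up := HN n Nn j jM.
(* The hypothesis is indexed by [j.+1], so [j * 2 ^ n] is its instance at [j.-1]. *)
have lo : `|m - mean y (j * 2 ^ n)| <= dl.
  by rewrite -(prednK j0); apply: HN => //=; rewrite prednK// ltnW.
have mE i : (0 < i)%N -> \sum_(l < i) y l = i%:R * mean y i.
  by move=> i0; rewrite /mean mulrA divff ?mul1r// pnatr_eq0 -lt0n.
have k0 : (0 < k)%N by apply: leq_trans jk; rewrite muln_gt0 j0.
have T1 := Tle _ _ jk; have T2 := Tle _ _ kj.
rewrite !mE ?muln_gt0 ?j0// in T1 T2.
have jR : M%:R <= j%:R :> R by rewrite ler_nat.
have k1 : j%:R * (2 ^ n)%:R <= k%:R :> R by rewrite -natrM ler_nat.
have k2 : k%:R <= (j%:R + 1) * (2 ^ n)%:R :> R by rewrite natr1 -natrM ler_nat.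
rewrite !natrM -natr1 in T1 T2.
have a0 := mean_ge0 k y0.
have b0 := mean_ge0 (j * 2 ^ n) y0; have c0 := mean_ge0 (j.+1 * 2 ^ n) y0.
have p0R : 0 < (2 ^ n)%:R :> R by rewrite ltr0n.
move: up lo; rewrite !ler_norml => /andP[up1 up2] /andP[lo1 lo2].
move: (mean y k) (mean y (j * 2 ^ n)) (mean y (j.+1 * 2 ^ n)) a0 b0 c0 T1 T2
  up1 up2 lo1 lo2 => a b c a0 b0 c0 T1 T2 up1 up2 lo1 lo2.
have j0R : 0 < j%:R :> R by rewrite ltr0n.
have aup : j%:R * a <= (j%:R + 1) * c.
  rewrite -(ler_pM2r p0R) mulrAC; apply: le_trans (ler_wpM2r a0 k1) _.
  by rewrite mulrAC.
have alo : j%:R * b <= (j%:R + 1) * a.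
  rewrite -(ler_pM2r p0R) mulrAC; apply: le_trans T1 _.
  by apply: le_trans (ler_wpM2r a0 k2) _; rewrite mulrAC.
have sm : m + 1 <= e / 2 * j%:R.
  by rewrite -ler_pdivrMr//; apply: le_trans Me; rewrite ler_wpM2l ?addr_ge0// lef_pV2 ?posrE.
have bm : b <= m + 1 by lra.
have cm : c <= m + 1 by lra.
apply/andP; split.
- rewrite -(ler_pM2l j0R); have h : j%:R * c <= j%:R * (m + e / 2) by rewrite ler_pM2l//; lra.
  lra.
- rewrite lerBlDr -(ler_pM2l j0R).
  have h : j%:R * (m - e / 2) <= j%:R * b by rewrite ler_pM2l//; lra.
  (* For [a > m + 1] the lower estimate of [a] is immediate; otherwise [alo] gives
     [j * b <= j * a + (m + 1)]. *)
  have [am|am] := leP a (m + 1); first by lra.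
  have h2 : j%:R * m <= j%:R * a by rewrite ler_pM2l//; lra.
  have : 0 <= e * j%:R by rewrite mulr_ge0// ltW.
  lra.
Qed.

(** Exchanging sum and integral turns a pointwise bound on partial sums, such as the two geometric
    ones, into a bound on the sum of the integrals. *)
Lemma nneseries_integral_le (d : measure_display) (U : measurableType d)
    (R : realType) (nu : {measure set U -> \bar R}) (u : nat -> U -> R) (F : U -> R) :
  (forall n, measurable_fun [set: U] (u n)) -> (forall n x, 0 <= u n x) ->
  measurable_fun [set: U] F -> (forall N x, \sum_(n < N) u n x <= F x) ->
  (\sum_(0 <= n <oo) \int[nu]_x (u n x)%:E <= \int[nu]_x (F x)%:E)%E.
Proof.
move=> mu u0 mF uF.
have meu n : measurable_fun [set: U] (fun x => (u n x)%:E) by exact/measurable_EFinP.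
rewrite -integral_nneseries//; last by move=> n x _; rewrite lee_fin.
apply: ge0_le_integral => //.
- by move=> x _; apply: nneseries_ge0 => n _ _; rewrite lee_fin.
- by apply: ge0_emeasurable_sum => [n x _ _|n _]; rewrite ?lee_fin.
- exact/measurable_EFinP.
move=> x _; apply: lime_le.
  by apply: is_cvg_nneseries => n _ _; rewrite lee_fin.
by apply: nearW => N; rewrite sumEFin lee_fin big_mkord.
Qed.

(** The difference [g ^ 2 - (g - c) ^ 2 = 2 * c * g - c ^ 2] integrates to [c ^ 2 >= 0]. *)
Lemma integral_sqr_centered_le (R : realType) (P : probability R R)
    (g : R -> R) (M c : R) :
  measurable_fun [set: R] g -> (forall x, `|g x| <= M) ->
  (\int[P]_x (g x)%:E = c%:E)%E ->
  (\int[P]_x ((g x - c) ^+ 2)%:E <= \int[P]_x (g x ^+ 2)%:E)%E.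
Proof.
move=> mg gM gc.
have M0 : 0 <= M by exact: le_trans (normr_ge0 _) (gM 0).
have Ig : P.-integrable [set: R] (EFin \o g) by apply: bounded_integrable gM.
have Ic (r : R) : P.-integrable [set: R] (EFin \o (fun=> r)).
  by apply: (@bounded_integrable _ _ _ _ _ `|r|).
have mh : measurable_fun [set: R] (fun x => g x - c) by exact: measurable_funB.
have Ih2 : P.-integrable [set: R] (EFin \o (fun x => (g x - c) ^+ 2)).
  apply: (@bounded_integrable _ _ _ _ _ ((M + `|c|) ^+ 2)); first exact: measurable_funX.
  move=> x; rewrite normrX lerXn2r ?nnegrE ?addr_ge0//.
  by apply: le_trans (ler_normB _ _) _; rewrite lerD2r.
have Icg : P.-integrable [set: R] (EFin \o (fun x => 2 * c * g x)).
  apply: (@bounded_integrable _ _ _ _ _ (`|2 * c| * M)); first exact: measurable_funM.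
  by move=> x; rewrite normrM ler_wpM2l.
have Er : (\int[P]_x (2 * c * g x - c ^+ 2)%:E = (c ^+ 2)%:E)%E.
  have := @integralD_EFin _ _ _ P _ measurableT _ _ Icg (Ic (- c ^+ 2)) => /= ->.
  under [X in (X + _)%E]eq_integral do rewrite EFinM.
  rewrite (@integralZl _ _ _ P _ measurableT _ Ig) gc integral_cst//=.
  rewrite probability_setT mule1 -EFinM -EFinD; congr EFin; ring.
have Irest : P.-integrable [set: R] (EFin \o (fun x => 2 * c * g x - c ^+ 2)).
  have := integrableD measurableT Icg (Ic (- c ^+ 2)).
  by congr (_.-integrable _ _); apply/funext => x.
have -> : (\int[P]_x (g x ^+ 2)%:E)%E =
    (\int[P]_x ((g x - c) ^+ 2 + (2 * c * g x - c ^+ 2))%:E)%E.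
  by apply: eq_integral => x _; congr EFin; ring.
have := @integralD_EFin _ _ _ P _ measurableT _ _ Ih2 Irest => /= ->.
by rewrite Er leeDl// lee_fin sqr_ge0.
Qed.

(** * Strong law of large numbers for nonnegative functions of i.i.d. observations *)

Section iid.
Context (R : realType) (P : probability R R) (d : measure_display)
  (T : measurableType d) (Pr : probability T R) (X : nat -> {RV Pr >-> R})
  (X_iid : iid_from P X).

Lemma iid_ge0_integral i (f : R -> \bar R) : measurable_fun [set: R] f ->
  (forall x, 0 <= f x)%E -> (\int[Pr]_w f (X i w) = \int[P]_x f x)%E.
Proof.
move=> mf f0; rewrite -(ge0_integral_distribution (X i))//.
by apply: eq_measure_integral => A mA _; exact: X_iid.2.
Qed.

(** The law of [(X i, X j)] is [P \x P], since by independence the two agree on rectangles; Fubini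
    then separates the factors. *)
Lemma iid_integral_mul i j (g h : R -> R) (M : R) : i != j ->
  measurable_fun [set: R] g -> measurable_fun [set: R] h ->
  (forall x, `|g x| <= M) -> (forall x, `|h x| <= M) ->
  (\int[Pr]_w (g (X i w) * h (X j w))%:E =
   (\int[P]_x (g x)%:E) * \int[P]_x (h x)%:E)%E.
Proof.
move=> ij mg mh gM hM.
have M0 : 0 <= M by exact: le_trans (normr_ge0 _) (gM 0).
have mZ : measurable_fun [set: T] (fun w => (X i w, X j w)).
  by apply: measurable_fun_pair.
pose Z : {RV Pr >-> (R * R)%type} := mfun_Sub (mem_set mZ).
pose f (z : R * R) := g z.1 * h z.2.
have mf : measurable_fun [set: R * R] f.
  by apply: measurable_funM; apply: measurableT_comp.
have fM z : `|f z| <= M * M by rewrite normrM ler_pM.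
have EP (A : set (R * R)) : measurable A -> (P \x P)%E A = distribution Pr Z A.
  apply: product_measure_unique => B C mB mC.
  (* Independence is stated for a whole family of sets; only its values at [i] and [j] enter, as the
     index set is [{i, j}]. *)
  pose D k := if k == i then B else C.
  have mD k : measurable (D k) by rewrite /D; case: ifPn.
  have := X_iid.1 [fset i; j]%fset D mD.
  rewrite big_fsetU1/= ?inE// big_seq_fset1 /D eqxx eq_sym (negbTE ij) => E.
  transitivity (distribution Pr (X i) B * distribution Pr (X j) C)%E; last first.
    by rewrite !X_iid.2.
  rewrite -[RHS]E; congr (Pr _); apply/seteqP; split => w /=.
    move=> [Bw Cw] k /=; rewrite !inE => /orP[] /eqP ->; first by rewrite eqxx.
    by rewrite eq_sym (negbTE ij).
  move=> H; split; first by have := H i; rewrite /= !inE eqxx/=; exact.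
  by have := H j; rewrite /= !inE eqxx orbT eq_sym (negbTE ij); exact.
have If : (P \x P)%E.-integrable [set: R * R] (EFin \o f).
  apply: (@bounded_integrable _ _ _ (P \x P)%E _ (M * M)) => //.
transitivity (\int[P \x P]_z (EFin \o f) z)%E.
  rewrite (eq_measure_integral (distribution Pr Z)); last by move=> A mA _; exact: EP.
  rewrite integral_distribution//; first exact/measurable_EFinP.
  apply: (@bounded_integrable _ _ _ Pr (f \o Z) (M * M)) => //.
    exact: measurableT_comp.
  by move=> w; exact: fM.
rewrite -integral12_prod_meas1// /fubini_F/=.
have Ig : P.-integrable [set: R] (EFin \o g) by apply: bounded_integrable gM.
have Ih : P.-integrable [set: R] (EFin \o h) by apply: bounded_integrable hM.
under eq_integral => x _.
  rewrite /f/=; under eq_integral do rewrite EFinM.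
  rewrite (@integralZl _ _ _ P _ _ (EFin \o h))//.
  over.
rewrite /=.
have fh : (\int[P]_x (h x)%:E)%E \is a fin_num by exact: (integrable_fin_num _ Ih).
under eq_integral do rewrite muleC.
by rewrite -(fineK fh) (@integralZl _ _ _ P _ _ (EFin \o g))// muleC.
Qed.

(** Induction on [k]: when the square is expanded, the cross term has integral 0 by pairwise
    independence and centering. *)
Lemma iid_integral_sqr_sum (h : R -> R) (M : R) k :
  measurable_fun [set: R] h -> (forall x, `|h x| <= M) ->
  (\int[P]_x (h x)%:E = 0)%E ->
  (\int[Pr]_w ((\sum_(i < k) h (X i w)) ^+ 2)%:E =
   k%:R%:E * \int[P]_x (h x ^+ 2)%:E)%E.
Proof.
move=> mh hM h0.
have M0 : 0 <= M by exact: le_trans (normr_ge0 _) (hM 0).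
have mhX i : measurable_fun [set: T] (fun w => h (X i w)) by exact: measurableT_comp.
have mS n : measurable_fun [set: T] (fun w => \sum_(i < n) h (X i w)).
  by apply: measurable_sum => i; exact: mhX.
have SM n w : `|\sum_(i < n) h (X i w)| <= n%:R * M.
  apply: le_trans (ler_norm_sum _ _ _) _.
  rewrite mulr_natl -[in leRHS](card_ord n) -sumr_const.
  exact: ler_sum.
have Ih2 : P.-integrable [set: R] (EFin \o (fun x => h x ^+ 2)).
  apply: (@bounded_integrable _ _ _ _ _ (M ^+ 2)); first exact: measurable_funX.
  by move=> x; rewrite normrX lerXn2r// nnegrE.
have fh2 := integrable_fin_num measurableT Ih2.
elim: k => [|k IH].
  by under eq_integral do rewrite big_ord0 expr0n/=; rewrite integral0 mul0e.
have cross : (\int[Pr]_w ((\sum_(i < k) h (X i w)) * h (X k w))%:E = 0)%E.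
  under eq_integral do rewrite mulr_suml -sumEFin.
  rewrite integral_sum//.
    rewrite big1// => i _; rewrite (@iid_integral_mul i k h h M)//.
      by rewrite h0 mule0.
    by rewrite ltn_eqF.
  move=> i; apply: (@bounded_integrable _ _ _ Pr (fun w => h (X i w) * h (X k w)) (M * M)).
    exact: measurable_funM.
  by move=> w; rewrite normrM ler_pM.
have I1 : Pr.-integrable [set: T] (EFin \o (fun w => (\sum_(i < k) h (X i w)) ^+ 2)).
  apply: (@bounded_integrable _ _ _ _ _ ((k%:R * M) ^+ 2)); first exact: measurable_funX.
  by move=> x; rewrite normrX lerXn2r ?nnegrE// mulr_ge0.
have I2 : Pr.-integrable [set: T]
    (EFin \o (fun w => (\sum_(i < k) h (X i w)) * h (X k w))).
  apply: (@bounded_integrable _ _ _ _ _ (k%:R * M * M)); first exact: measurable_funM.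
  by move=> x; rewrite normrM ler_pM.
have I3 : Pr.-integrable [set: T] (EFin \o (fun w => h (X k w) ^+ 2)).
  apply: (@bounded_integrable _ _ _ _ _ (M ^+ 2)); first exact: measurable_funX.
  by move=> x; rewrite normrX lerXn2r// nnegrE.
under eq_integral => w _.
  rewrite big_ord_recr/= sqrrD mulr2n !EFinD.
  over.
have I22 := integrableD measurableT I2 I2.
have I122 := integrableD measurableT I1 I22.
rewrite /= integralD//=.
rewrite integralD//= integralD//= cross IH.
rewrite (@iid_ge0_integral k (fun x => (h x ^+ 2)%:E)).
- by rewrite -(fineK fh2) -!EFinM -!EFinD -natr1 /= !addr0 mulrDl mul1r.
- by apply/measurable_EFinP; exact: measurable_funX.
- by move=> x; rewrite lee_fin sqr_ge0.
Qed.

(* The summands are truncated at the number of summands [k = j.+1 * 2 ^ n]; since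
   these [k] grow geometrically, both the variances of the truncated means and
   the probabilities that truncation matters are summable in [n]. *)
Lemma slln_dyadic (f : R -> R) (j : nat) :
  measurable_fun [set: R] f -> (forall x, 0 <= f x) ->
  P.-integrable [set: R] (EFin \o f) ->
  {ae Pr, forall w, (fun n => mean (fun i => f (X i w)) (j.+1 * 2 ^ n)) @ \oo -->
    (\int[P]_x f x)%R}.
Proof.
move=> mf f0 If.
pose k n := (j.+1 * 2 ^ n)%N.
pose K n : R := j.+1%:R * 2 ^+ n.
have kK n : (k n)%:R = K n by rewrite /k natrM natrX.
have K0 n : 0 < K n by rewrite mulr_gt0// exprn_gt0.
have k0 n : (0 < k n)%N by rewrite muln_gt0/= expn_gt0.
pose A n := [set x | f x <= K n].
have mA n : measurable (A n).
  by rewrite -[A n]setTI; apply: measurable_fun_le => //; exact: measurable_cst.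
have AE n x : \1_(A n) x = (f x <= K n)%R%:R :> R.
  by rewrite indicE; congr (nat_of_bool _)%:R; apply/idP/idP; rewrite inE.
have ACE n x : \1_(~` A n) x = (K n < f x)%R%:R :> R.
  rewrite indicE in_setC ltNge; congr (nat_of_bool (~~ _))%:R.
  by apply/idP/idP; rewrite inE.
pose g n x := f x * \1_(A n) x.
have mg n : measurable_fun [set: R] (g n).
  by apply: measurable_funM => //; exact: measurable_indic.
have g0 n x : 0 <= g n x by rewrite mulr_ge0.
have gf n x : g n x <= f x by rewrite ler_piMr// AE; case: (_ <= _).
have gK n x : `|g n x| <= K n.
  by rewrite ger0_norm// /g AE; case: (leP (f x)) => fK; rewrite ?mulr1 ?mulr0 ?(ltW (K0 n)).
have Ig n : P.-integrable [set: R] (EFin \o g n) by apply: bounded_integrable (gK n).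
pose c n := fine (\int[P]_x (g n x)%:E)%E.
have cE n : (\int[P]_x (g n x)%:E = (c n)%:E)%E.
  by rewrite fineK//; exact: (integrable_fin_num _ (Ig n)).
pose h n x := g n x - c n.
have mh n : measurable_fun [set: R] (h n) by exact: measurable_funB.
have hM n x : `|h n x| <= K n + `|c n|.
  by apply: le_trans (ler_normB _ _) _; rewrite lerD2r.
have h_0 n : (\int[P]_x (h n x)%:E = 0)%E.
  have Ic : P.-integrable [set: R] (EFin \o (fun=> - c n)).
    by apply: (@bounded_integrable _ _ _ _ _ `|- c n|).
  have := @integralD_EFin _ _ _ P _ measurableT _ _ (Ig n) Ic => /= ->.
  rewrite cE integral_cst//= probability_setT.
  by rewrite mule1 -EFinD subrr.
pose S n w := \sum_(i < k n) h n (X i w).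
have mS n : measurable_fun [set: T] (S n).
  by apply: measurable_sum => i; exact: measurableT_comp.
(* [D n] is the squared deviation of the truncated mean from its expectation [c n]; [B n] counts the
   truncated observations among the first [k n]. Both are shown to have summable integrals. *)
pose D n w := ((K n)^-1 * S n w) ^+ 2.
pose B n w : R := \sum_(i < k n) \1_(~` A n) (X i w).
have mB n : measurable_fun [set: T] (B n).
  apply: measurable_sum => i; apply: measurableT_comp => //.
  by apply: measurable_indic; exact: measurableC.
have foo : (\int[P]_x (2 * f x)%:E < +oo)%E.
  apply: integrable_lty => //.
  by have := integrableZl measurableT 2 If; congr (_.-integrable _ _).
have cD : {ae Pr, forall w, cvgn (series (D ^~ w))}.
  apply: ae_cvg_series => [n|n w|]; first 2 last.
  - apply: le_lt_trans foo.
    (* The variance of the truncated mean is at most the second moment of [g n] divided by [K n];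
       [sum_geometric_tail] bounds the sum of the integrands by [2 * f]. *)
    apply: (@le_trans _ _ (\sum_(0 <= n <oo) \int[P]_x ((K n)^-1 * g n x ^+ 2)%:E)%E).
      apply: lee_nneseries => [n _ _|n _].
        by apply: integral_ge0 => w _; rewrite lee_fin sqr_ge0.
      have -> : (\int[Pr]_w (D n w)%:E = (((K n)^-1)%:E * \int[P]_x (h n x ^+ 2)%:E))%E.
        rewrite /D; under eq_integral do rewrite exprMn EFinM.
        rewrite ge0_integralZl//; last 3 first.
        - by apply/measurable_EFinP; exact: measurable_funX.
        - by move=> w _; rewrite lee_fin sqr_ge0.
        - by rewrite lee_fin sqr_ge0.
        rewrite (iid_integral_sqr_sum (k n) (mh n) (hM n) (h_0 n)) kK muleA -EFinM.
        by congr (_%:E * _)%E; rewrite expr2 -mulrA mulVf ?mulr1// gt_eqF.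
      under [leRHS]eq_integral do rewrite EFinM.
      rewrite ge0_integralZl//; last 3 first.
      - by apply/measurable_EFinP; exact: measurable_funX.
      - by move=> x _; rewrite lee_fin sqr_ge0.
      - by rewrite lee_fin invr_ge0 ltW.
      apply: lee_pmul => //.
      + by rewrite lee_fin invr_ge0 ltW.
      + by apply: integral_ge0 => w _; rewrite lee_fin sqr_ge0.
      + exact: integral_sqr_centered_le (gK n) (cE n).
    apply: nneseries_integral_le => //.
    + by move=> n; apply: measurable_funM => //; exact: measurable_funX.
    + by move=> n x; rewrite mulr_ge0 ?sqr_ge0 ?invr_ge0 ?ltW.
    + exact: measurable_funM.
    move=> N x; apply: le_trans (sum_geometric_tail N (f0 x) (_ : 0 < j.+1%:R)) => //.
    apply: ler_sum => n _; rewrite /g AE -/(K n).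
    by case: (f x <= K n)%R; rewrite ?mulr1 ?mulr0 ?expr0n/= ?mulr0 ?mul0r ?mul1r// mulrC.
  - by apply: measurable_funX; exact: measurable_funM.
  - exact: sqr_ge0.
have cB : {ae Pr, forall w, cvgn (series (B ^~ w))}.
  apply: ae_cvg_series => [n|n w|]; first 2 last.
  - apply: le_lt_trans foo.
    (* The expected count is [K n] times the probability that [f > K n]; [sum_geometric_head] bounds
       the sum of the integrands by [2 * f]. *)
    apply: (@le_trans _ _ (\sum_(0 <= n <oo) \int[P]_x (K n * \1_(~` A n) x)%:E)%E).
      apply: lee_nneseries => [n _ _|n _].
        by apply: integral_ge0 => w _; rewrite lee_fin sumr_ge0.
      rewrite /B; under eq_integral do rewrite -sumEFin.
      have mI : measurable_fun [set: R] (fun x => (\1_(~` A n) x : R)%:E).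
        by apply/measurable_EFinP; apply: measurable_indic; exact: measurableC.
      rewrite ge0_integral_sum//; last first.
        by move=> i; apply: (measurableT_comp mI).
      under eq_bigr do rewrite (@iid_ge0_integral _ (fun x => (\1_(~` A n) x)%:E))//.
      under [leRHS]eq_integral do rewrite EFinM.
      rewrite ge0_integralZl//; last by rewrite lee_fin ltW.
      have fI : (\int[P]_x (\1_(~` A n) x)%:E)%E \is a fin_num.
        apply: (@integrable_fin_num _ _ _ P _ _ (EFin \o \1_(~` A n))) => //.
        apply: (@bounded_integrable _ _ _ _ _ 1); first exact/measurable_EFinP.
        by move=> x; rewrite ACE; case: (_ < _)%R; rewrite ?normr1 ?normr0.
      by rewrite -(fineK fI) sumEFin sumr_const card_ord -kK -EFinM mulr_natl.
    apply: nneseries_integral_le => //.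
    + move=> n; apply: measurable_funM => //.
      by apply: measurable_indic; exact: measurableC.
    + by move=> n x; rewrite mulr_ge0// ltW.
    + exact: measurable_funM.
    move=> N x; apply: le_trans (sum_geometric_head N (f0 x) (_ : 0 < j.+1%:R)) => //.
    apply: ler_sum => n _; by rewrite ACE mulrC.
  - exact: mB.
  - exact: sumr_ge0.
(* Dominated convergence: at a fixed [x], [K n >= 2 ^ n > n], so truncation eventually has no
   effect. *)
have cc : c @ \oo --> (\int[P]_x f x)%R.
  have mef : measurable_fun [set: R] (EFin \o f) by exact/measurable_EFinP.
  have meg n : measurable_fun [set: R] (EFin \o g n) by exact/measurable_EFinP.
  have gcvg : {ae P, forall x, [set: R] x -> (EFin \o g n) x @[n --> \oo] --> (EFin \o f) x}.
    apply: aeW => x _; apply: cvg_near_cst.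
    exists (Num.bound (f x)) => // n /= xn; rewrite /g AE.
    suff -> : f x <= K n by rewrite mulr1.
    apply: le_trans (ltW (archi_boundP (f0 x))) _.
    rewrite -kK ler_nat; apply: leq_trans xn _.
    by rewrite (leq_trans (ltnW (ltn_expl n (isT : 1 < 2)%N)))// leq_pmull.
  have gdom : {ae P, forall x n, [set: R] x -> (`|(EFin \o g n) x| <= (EFin \o f) x)%E}.
    by apply: aeW => x n _; rewrite /= lee_fin ger0_norm.
  have [_ _] := dominated_convergence measurableT meg mef gcvg If gdom.
  by rewrite -[X in _ --> X](fineK (integrable_fin_num _ If))// => /fine_cvg.
move: cD cB; apply: filterS2 => w /cvg_series_cvg_0 Dw /cvg_series_cvg_0 Bw.
have Sw : (fun n => (K n)^-1 * S n w) @ \oo --> (0 : R).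
  apply/cvgr0Pnorm_le => e e0.
  have e2 : 0 < e ^+ 2 by rewrite exprn_gt0.
  have /cvgr0Pnorm_le/(_ _ e2) := Dw; apply: filterS => n.
  by rewrite normrX ler_pXn2r// ?nnegrE ?normr_ge0 ?ltW.
rewrite -[X in _ --> X]addr0.
apply: cvg_trans (cvgD cc Sw); apply: near_eq_cvg.
(* A single truncated observation already makes [B n >= 1], so once [B n < 1] the truncated mean is
   the original one. *)
have /cvgr0Pnorm_lt/(_ _ ltr01) := Bw; apply: filterS => n Bn.
have fA (i : 'I_(k n)) : \1_(~` A n) (X i w) = 0 :> R.
  rewrite ACE; case: ltP => // Kf; suff : 1 < 1 :> R by rewrite ltxx.
  apply: le_lt_trans Bn; apply: le_trans (ler_norm _).
  rewrite /B (bigD1 i)//= ACE Kf lerDl; exact: sumr_ge0.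
transitivity (mean (fun i => g n (X i w)) (k n)).
  rewrite [LHS]/(c n + (K n)^-1 * S n w) /S /h sumrB sumr_const.
  rewrite card_ord -kK -[c n *+ _]mulr_natl /mean mulrBr.
  by rewrite mulKf ?pnatr_eq0 -?lt0n//; exact: subrKC.
congr (_ * _); apply: eq_bigr => i _.
have := fA i; rewrite /g ACE AE; case: ltP => /= _; last by rewrite mulr1.
by move=> /eqP; rewrite oner_eq0.
Qed.

(** There are countably many [j], so almost surely the dyadic limits hold for all of them at
    once. *)
Lemma slln_ge0 (f : R -> R) :
  measurable_fun [set: R] f -> (forall x, 0 <= f x) ->
  P.-integrable [set: R] (EFin \o f) ->
  {ae Pr, forall w, mean (fun i => f (X i w)) @ \oo --> (\int[P]_x f x)%R}.
Proof.
move=> mf f0 If.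
have := ae_foralln (fun j => slln_dyadic j mf f0 If).
by apply: filterS => w H; apply: cvg_mean_dyadic.
Qed.

End iid.

(** * Power sums, measurability of the estimators, and the passage from moments to paths *)

Lemma powR_telescope (R : realType) (g : R) (i : nat) : 0 < g ->
  i.+2%:R `^ (- g) / i.+2%:R <= g^-1 * (i.+1%:R `^ (- g) - i.+2%:R `^ (- g)).
Proof.
move=> g0.
have a0 : 0 < i.+1%:R :> R by rewrite ltr0n.
have b0 : 0 < i.+2%:R :> R by rewrite ltr0n.
rewrite -ler_pdivrMl ?invr_gt0// invrK.
(* Factoring out [(i + 2) ^ (- g)] leaves [exp (g * ln ((i + 2) / (i + 1))) - 1], which is at least
   [g / (i + 2)] by [exp x >= 1 + x] and [ln (1 + x) <= x]. *)
have -> : i.+1%:R `^ (- g) = i.+2%:R `^ (- g) * expR (g * (ln i.+2%:R - ln i.+1%:R)) :> R.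
  rewrite /powR !gt_eqF// -expRD; congr expR; ring.
rewrite -[X in _ <= _ - X]mulr1 -mulrBr mulrCA ler_wpM2l ?powR_ge0//.
apply: (@le_trans _ _ (g * (ln i.+2%:R - ln i.+1%:R))); last first.
  by rewrite lerBrDl; exact: expR_ge1Dx.
rewrite ler_pM2l//.
have -> : ln i.+2%:R - ln i.+1%:R = - ln (i.+1%:R / i.+2%:R) :> R.
  by rewrite ln_div// opprB.
rewrite lerNr; have -> : i.+1%:R / i.+2%:R = 1 + - i.+2%:R^-1 :> R.
  have -> : i.+1%:R = i.+2%:R - 1 :> R by rewrite -[i.+2%:R]natr1 addrK.
  by rewrite mulrBl divff ?gt_eqF// mul1r.
apply: le_ln1Dx.
by rewrite ltrN2 invf_lt1// ltr1n.
Qed.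

(** Since [i + 2 <= 2 * (i + 1)], replacing [i + 1] by [i + 2] inside the power costs at most the
    factor [2 ^ g]; the sum then telescopes. *)
Lemma sum_powR_le (R : realType) (g : R) (N : nat) : 0 < g ->
  \sum_(i < N) i.+1%:R `^ (- g) / i.+2%:R <= 2 `^ g * g^-1.
Proof.
move=> g0.
have step i : i.+1%:R `^ (- g) / i.+2%:R <=
    2 `^ g * g^-1 * (i.+1%:R `^ (- g) - i.+2%:R `^ (- g)) :> R.
  rewrite -mulrA; apply: le_trans (ler_wpM2l (powR_ge0 _ _) (powR_telescope i g0)).
  rewrite mulrA ler_wpM2r ?invr_ge0//.
  have -> : i.+1%:R = 2^-1 * (2 * i.+1%:R) :> R by rewrite mulKf.
  rewrite powRM ?invr_ge0 ?mulr_ge0//.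
  rewrite -powR_inv1// -powRrM mulN1r opprK ler_wpM2l ?powR_ge0//.
  rewrite !powRN lef_pV2 ?posrE ?powR_gt0 ?mulr_gt0//.
  by rewrite ge0_ler_powR ?nnegrE ?(ltW g0)// -natrM ler_nat; lia.
apply: (@le_trans _ _ (\sum_(i < N) 2 `^ g * g^-1 * (i.+1%:R `^ (- g) - i.+2%:R `^ (- g)))).
  by apply: ler_sum => i _.
rewrite -mulr_sumr -[leRHS]mulr1 ler_wpM2l ?mulr_ge0 ?powR_ge0 ?invr_ge0 ?(ltW g0)//.
have -> : \sum_(i < N) (i.+1%:R `^ (- g) - i.+2%:R `^ (- g)) = 1 - N.+1%:R `^ (- g).
  elim: N => [|N IH]; first by rewrite big_ord0 powR1 subrr.
  by rewrite big_ord_recr/= IH addrA subrK.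
by rewrite gerBl powR_ge0.
Qed.

Lemma adapted_measurable (d : measure_display) (T : measurableType d)
    (R : realType) (X : nat -> T -> R) (Y : nat -> T -> R) n :
  (forall i, measurable_fun [set: T] (X i)) ->
  adapted (canonical_filtration X) Y -> measurable_fun [set: T] (Y n).
Proof.
move=> mX aY _ B mB; rewrite setTI.
have : canonical_filtration X n (Y n @^-1` B) by exact: aY.
rewrite /canonical_filtration /g_sigma_preimage.
apply: smallest_sub; first exact: sigma_algebra_measurable.
(* The generating class is a finite union, over the observations, of their classes of preimages. *)
elim/big_ind : _ => //.
- by move=> A1 A2 h1 h2 C [/h1|/h2].
- by move=> i _ _ [C mC <-]; exact: mX.
Qed.

(** Eventually [log R_n > n * l / 2], and [R_n > log R_n], so [R_n] exceeds any bound. *)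
Lemma cvg_log_growth_gt0 (T : Type) (R : realType) (X mut sigmat : nat -> T -> R)
    (w : T) (l : R) : 0 < l ->
  (fun n => log_growth X mut sigmat n w) @ \oo --> l%:E ->
  (fun n => likelihood_ratio X mut sigmat n w) @ \oo --> +oo /\
  (0 < limn_einf (fun n => log_growth X mut sigmat n w))%E.
Proof.
move=> l0 cl; split; last first.
  have -> := (cvg_limn_einf_sup cl).1; by rewrite lte_fin.
apply/cvgryPge => M.
have l2 : ((l / 2)%:E < l%:E)%E by rewrite lte_fin gtr_pMr// invf_lt1// ltr1n.
have : \forall n \near \oo, ((l / 2)%:E < log_growth X mut sigmat n w)%E.
  apply: (cl [set y | ((l / 2)%:E < y)%E]); apply: open_nbhs_nbhs.
  by split => //; exact: open_ereal_gt_ereal.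
move=> H; near=> n.
have n0 : (0 < n)%N by near: n; exact: nbhs_infty_gt.
have nR : 0 < n%:R :> R by rewrite ltr0n.
have : ((l / 2)%:E < log_growth X mut sigmat n w)%E by near: n.
rewrite /log_growth; set L := likelihood_ratio _ _ _ _ _.
(* For [L <= 0] the value of [lne] is [-oo], which contradicts the lower bound. *)
have [L0|L0] := leP L 0.
  by rewrite le0_lneNy ?lee_fin// gt0_muleNy ?lte_fin ?invr_gt0.
rewrite lne_EFin// -EFinM lte_fin ltr_pdivlMl// => /ltW h.
apply: (@le_trans _ _ (n%:R * (l / 2))).
  by rewrite -ler_pdivrMr ?divr_gt0//; near: n; exact: nbhs_infty_ger.
apply: le_trans h _.
by apply: ltW; exact: ln_sublinear.
Unshelve. all: end_near. Qed.

Lemma ae_mean_moment_cvg0 (d : measure_display) (T : measurableType d)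
    (R : realType) (Pr : probability T R) (u : nat -> T -> R) (gamma C : R) :
  0 < gamma -> (forall n, measurable_fun [set: T] (u n)) ->
  (forall n w, 0 <= u n w) ->
  (forall n, (1 <= n)%N ->
    (\int[Pr]_w (u n w)%:E <= (C * n%:R `^ (- gamma))%:E)%E) ->
  {ae Pr, forall w, mean (u ^~ w) @ \oo --> (0 : R)}.
Proof.
move=> g0 mu u0 uC.
(* The summand [u i / (i + 1)] of Kronecker's lemma at [i = n + 1]: the moment bound starts at index
   1. *)
pose f n w := n.+2%:R^-1 * u n.+1 w.
have : {ae Pr, forall w, cvgn (series (f ^~ w))}.
  apply: ae_cvg_series => [n|n w|]; first exact: measurable_funM.
    by rewrite mulr_ge0// invr_ge0.
  (* The absolute value is taken because [C] comes without a sign. *)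
  apply: (@le_lt_trans _ _ (`|C| * (2 `^ gamma * gamma^-1))%:E); last exact: ltry.
  have If n : (\int[Pr]_w (f n w)%:E <= (`|C| * (n.+1%:R `^ (- gamma) / n.+2%:R))%:E)%E.
    rewrite /f; under eq_integral do rewrite EFinM.
    rewrite ge0_integralZl//; last 2 first.
    - exact/measurable_EFinP.
    - by move=> w _; rewrite lee_fin.
    apply: le_trans (lee_wpmul2l _ (uC n.+1 isT)) _; first by rewrite lee_fin invr_ge0.
    rewrite -EFinM lee_fin mulrC -mulrA.
    by rewrite ler_wpM2r ?ler_norm// mulr_ge0 ?powR_ge0 ?invr_ge0.
  apply: lime_le.
    apply: is_cvg_nneseries => n _ _; apply: integral_ge0 => w _.
    by rewrite lee_fin mulr_ge0// invr_ge0.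
  apply: nearW => N; apply: (@le_trans _ _
    (\sum_(0 <= n < N) (`|C| * (n.+1%:R `^ (- gamma) / n.+2%:R))%:E)%E).
    by apply: lee_sum => n _; exact: If.
  by rewrite sumEFin lee_fin -mulr_sumr ler_wpM2l// big_mkord sum_powR_le.
apply: filterS => w cf; apply: kronecker.
(* Dropping the term of index 0 does not affect convergence. *)
rewrite -(is_cvg_series_restrict 1); apply/cvg_ex; case/cvg_ex: cf => l fl.
exists l; rewrite -cvg_shiftS; apply: cvg_trans fl; apply: near_eq_cvg.
apply: nearW => n; rewrite /series/= big_add1/=.
by apply: eq_bigr => i _; rewrite /f mulrC.
Qed.

(** * Moments of [P] and the almost sure limit *)

Lemma second_moment (R : realType) (P : probability R R) (mu sigma : R) :
  P.-integrable [set: R] (EFin \o (fun x : R => x)) ->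
  ('E_P[(fun x : R => x)] = mu%:E)%E ->
  ('V_P[(fun x : R => x)] = (sigma ^+ 2)%:E)%E ->
  [/\ P.-integrable [set: R] (EFin \o (fun x => (x - mu) ^+ 2)),
      (\int[P]_x (x - mu) ^+ 2)%R = sigma ^+ 2,
      P.-integrable [set: R] (EFin \o (fun x => x ^+ 2)) &
      (\int[P]_x x ^+ 2)%R = mu ^+ 2 + sigma ^+ 2].
Proof.
move=> Ix Ex Vx.
have mc : measurable_fun [set: R] (fun x : R => (x - mu) ^+ 2).
  by apply: measurable_funX; exact: measurable_funB.
have c2 : (\int[P]_x ((x - mu) ^+ 2)%:E = (sigma ^+ 2)%:E)%E.
  rewrite -Vx /variance unlock Ex unlock; apply: eq_integral => x _ /=.
  by rewrite expr2.
have Ic2 : P.-integrable [set: R] (EFin \o (fun x => (x - mu) ^+ 2)).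
  apply/integrableP; split; first exact/measurable_EFinP.
  rewrite (_ : (\int[P]_x _)%E = (sigma ^+ 2)%:E) ?ltry// -c2.
  by apply: eq_integral => x _; rewrite /= ger0_norm ?sqr_ge0.
have Il : P.-integrable [set: R] (EFin \o (fun x => 2 * mu * x)).
  by have := integrableZl measurableT (2 * mu) Ix; congr (_.-integrable _ _).
have Ic : P.-integrable [set: R] (EFin \o (fun=> - mu ^+ 2)).
  by apply: (@bounded_integrable _ _ _ _ _ `|- mu ^+ 2|).
have Ilc : P.-integrable [set: R] (EFin \o (fun x => 2 * mu * x - mu ^+ 2)).
  by have := integrableD measurableT Il Ic; congr (_.-integrable _ _).
(* The second part is affine in [x], hence integrable, with integral
   [2 * mu ^ 2 - mu ^ 2 = mu ^ 2]. *)
have E : (fun x : R => x ^+ 2) = (fun x => (x - mu) ^+ 2 + (2 * mu * x - mu ^+ 2)).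
  by apply/funext => x; ring.
split => //.
- by rewrite /Rintegral c2.
- by rewrite E; have := integrableD measurableT Ic2 Ilc; congr (_.-integrable _ _).
- rewrite E RintegralD// /Rintegral c2.
  have := @integralD_EFin _ _ _ P _ measurableT _ _ Il Ic => /= ->.
  under [X in (X + _)%E]eq_integral do rewrite EFinM.
  rewrite (@integralZl _ _ _ P _ measurableT _ Ix) integral_cst//= probability_setT.
  move: Ex; rewrite unlock => /= ->; rewrite mule1 -EFinM -EFinD /=; ring.
Qed.

Theorem proposition3p3 (R : realType) (P : probability R R) (mu sigma : R)
  (sigma_gt0 : 0 < sigma)
  (P_integrable : P.-integrable [set: R] (EFin \o (fun x : R => x)))
  (P_mean : ('E_P[(fun x : R => x)] = mu%:E)%E)
  (P_variance : ('V_P[(fun x : R => x)] = (sigma ^+ 2)%:E)%E)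
  (d : measure_display) (T : measurableType d) (Pr : probability T R)
  (X : nat -> {RV Pr >-> R}) (X_iid : iid_from P X)
  (mut sigmat : nat -> T -> R)
  (mut_adapted : adapted (canonical_filtration X) mut)
  (sigmat_adapted : adapted (canonical_filtration X) sigmat)
  (sigmat_gt0 : forall n w, 0 < sigmat n w)
  (gamma C : R) (gamma_gt0 : 0 < gamma)
  (mut_moment : forall n, (1 <= n)%N ->
    ('E_Pr[(fun w => (`|mut n w - mu| ^+ 3)%R)] <= (C * n%:R `^ (- gamma))%:E)%E)
  (sigmat_moment : forall n, (1 <= n)%N ->
    ('E_Pr[(fun w => ((sigmat n w ^- 2 - sigma ^- 2) ^+ 2)%R)]
       <= (C * n%:R `^ (- gamma))%:E)%E)
  (sigmat_cvg : {ae Pr, forall w,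
    (fun n => sigmat n w ^- 2) @ \oo --> sigma ^- 2})
  (sigmat_limsup :
    (limn_esup (fun n => 'E_Pr[(fun w => (sigmat n w ^- 6)%R)]) < +oo)%E) :
  {ae Pr, forall w,
    (fun n => log_growth X mut sigmat n w) @ \oo -->
      (2^-1 * ln (1 + mu ^+ 2 / sigma ^+ 2))%:E} /\
  ((forall A : set R, measurable A -> P A = normal_prob mu sigma A) ->
   mu != 0 ->
   {ae Pr, forall w,
     (fun n => likelihood_ratio X mut sigmat n w) @ \oo --> +oo /\
     (0 < limn_einf (fun n => log_growth X mut sigmat n w))%E}).
Proof.
have [Ic2 c2 Ix2 x2] := second_moment P_integrable P_mean P_variance.
have m2 (c : R) : measurable_fun [set: R] (fun x : R => (x - c) ^+ 2).
  by apply: measurable_funX; exact: measurable_funB.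
have mut3 : {ae Pr, forall w, mean (fun i => `|mut i w - mu| ^+ 3) @ \oo --> (0 : R)}.
  apply: (ae_mean_moment_cvg0 gamma_gt0).
  - move=> n; apply: measurable_funX; apply: measurableT_comp => //.
    apply: measurable_funB => //; exact: (adapted_measurable n _ mut_adapted).
  - by move=> n w; exact: exprn_ge0.
  - by move=> n n1; have := mut_moment n n1; rewrite unlock; exact.
(* The averages of [(x - mu) ^ 2] and [x ^ 2] are all that the pathwise limit asks of the
   observations. *)
have sc := slln_ge0 X_iid (m2 mu) (fun=> sqr_ge0 _) Ic2.
have sx : {ae Pr, forall w, mean (fun i => X i w ^+ 2) @ \oo --> (\int[P]_x x ^+ 2)%R}.
  exact: (slln_ge0 X_iid (exprn_measurable 2) (fun=> sqr_ge0 _) Ix2).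
rewrite c2 in sc; rewrite x2 in sx.
have cvg_lg : {ae Pr, forall w, (fun n => log_growth X mut sigmat n w) @ \oo -->
      (2^-1 * ln (1 + mu ^+ 2 / sigma ^+ 2))%:E}.
  apply: filter_app sigmat_cvg; apply: filter_app mut3; apply: filter_app sx.
  by apply: filterS sc => w xmu2w x2w m3w sw; exact: cvg_log_growth.
split => // _ mu0; move: cvg_lg; apply: filterS => w; apply: cvg_log_growth_gt0.
(* A nonzero [mu] puts the argument of [ln] above 1, so the rate is positive. *)
have mu2 : 0 < mu ^+ 2 by rewrite exprn_even_gt0.
by rewrite mulr_gt0 ?invr_gt0// ln_gt0// ltrDl divr_gt0// exprn_gt0.
Qed.
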